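(* Let $A\in\mathbb M_m$ be a Perron-like matrix with principal eigenvalue $s=s(A)$, let $\delta>0$ be such that $\mathrm{Re}\,\mu\le s-2\delta$ for all $\mu\in\sigma(A)\setminus\{s\}$, and let $\{v_i\}_{i\in J}$ be a basis of $\mathbb R^m$. Put $x_i(t)=e^{tA}v_i$ and $X(t)=[x_i(t)]_{i\in J}$. Then there exist $B_1,B_2>0$ and vectors $\xi_i\in \mathrm{E}_s(A)$ $(i\in J)$ with $$\sum_{i\in J}\|\xi_i\|^2=1\quad\text{and}\quad \mathrm{DE}_s(A)=\mathrm{span}\{\xi_i: i\in J\}$$ such that, for every $i\in J$, $$\left\|\frac{x_i(t)}{\|X(t)\|}-\xi_i\right\|\le O(t^{-1})+B_1e^{-\delta t},\qquad t\ge1,$$ and $$\left|\frac{1}{\|X(t)\|^2}\sum_{i\in J}\langle Ax_i(t),x_i(t)\rangle-s\right|\le O(t^{-1})+B_2e^{-\delta t},\qquad t\ge1.$$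
   Context: $J=\{1,\dots,m\}$. $\mathbb M_m$ is the space of real $m\times m$ matrices; $[\alpha_i]_{i\in J}$ denotes the matrix with columns $\alpha_i$. $\mathbb R^m$ carries the Euclidean inner product and norm; on $\mathbb M_m$, $\|[\alpha_i]_{i\in J}\|=(\sum_{i\in J}\|\alpha_i\|^2)^{1/2}$. $\sigma(A)$ is the set of (complex) eigenvalues of $A$, $s(A)=\max\{\mathrm{Re}\,\mu:\mu\in\sigma(A)\}$. $A$ is Perron-like if $s:=s(A)\in\sigma(A)$ and $\mathrm{Re}\,\mu<s$ for all $\mu\in\sigma(A)\setminus\{s\}$; $s$ is then called the principal eigenvalue. $\mathrm{E}_s(A)=\ker(A-sI)$; $\mathrm{GE}_s(A)=\{\xi\in\mathbb R^m:(A-sI)^k\xi=0\text{ for some }k\ge1\}$. For $0\ne\xi\in\mathrm{GE}_s(A)$, $\mathrm{Ord}(\xi)$ is the smallest $k\ge1$ with $(A-sI)^k\xi=0$; $\mathrm{Cord}(\mathrm{GE}_s(A))=\max_{\xi}\mathrm{Ord}(\xi)$ (cyclic order). With $\nu=\mathrm{Cord}(\mathrm{GE}_s(A))$, a dominant eigenvector is an eigenvector $w\in\mathrm E_s(A)$ of the form $w=(A-sI)^{\nu-1}\xi$ for some $\xi\in\mathrm{GE}_s(A)$, and the dominant eigenspace $\mathrm{DE}_s(A)$ is the span of the dominant eigenvectors. $O(t^{-1})$ denotes a quantity bounded in absolute value by $Ct^{-1}$ for some constant $C>0$ independent of $t$. *)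

(* Defs.v *)
From HB Require Import structures.
From mathcomp Require Import all_boot all_order all_algebra.
From mathcomp Require Export complex.
From mathcomp Require Import all_classical all_reals all_analysis.

Set Implicit Arguments.
Unset Strict Implicit.
Unset Printing Implicit Defensive.

Import Order.TTheory GRing.Theory Num.Theory.
Import numFieldNormedType.Exports.

Local Open Scope classical_set_scope.
Local Open Scope complex_scope.
Local Open Scope ring_scope.

(* The library norm on 'M[R]_(m, n) is the sup norm, hence the explicit
   Euclidean inner product and norms. *)
Definition dotcv (R : realType) (m : nat) (u v : 'cV[R]_m) : R :=
  \sum_(k < m) u k 0 * v k 0.

Definition norm2 (R : realType) (m : nat) (u : 'cV[R]_m) : R :=
  Num.sqrt (dotcv u u).

Definition mx_of_cols (R : realType) (m : nat) (alpha : 'I_m -> 'cV[R]_m) :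
  'M[R]_m := \matrix_(k, i) alpha i k 0.

Definition mxnorm2 (R : realType) (m : nat) (X : 'M[R]_m) : R :=
  Num.sqrt (\sum_(i < m) norm2 (col i X) ^+ 2).

Definition expmx (R : realType) (m : nat) (A : 'M[R]_m) : 'M[R]_m :=
  limn (series (fun k : nat => (k`!%:R)^-1 *: A ^+ k)).

(* eigenvalue and eigenspace act on row vectors; the transpose makes this
   { mu | A z = mu z for some nonzero complex column z }. *)
Definition spectrum (R : realType) (m : nat) (A : 'M[R]_m) : set R[i] :=
  [set mu | eigenvalue (map_mx (real_complex R) A)^T mu].

(* The spectrum is finite, and nonempty for 0 < m, so this sup is a max. *)
Definition spectral_bound (R : realType) (m : nat) (A : 'M[R]_m) : R :=
  sup [set complex.Re mu | mu in spectrum A].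

Definition perron_like (R : realType) (m : nat) (A : 'M[R]_m) : Prop :=
  let s := spectral_bound A in
  spectrum A s%:C /\
  forall mu : R[i], spectrum A mu -> mu <> s%:C -> complex.Re mu < s.

Definition Espace (R : realType) (m : nat) (A : 'M[R]_m) (s : R) :
  set 'cV[R]_m := [set w | (A - s%:M) *m w = 0].

Definition GEspace (R : realType) (m : nat) (A : 'M[R]_m) (s : R) :
  set 'cV[R]_m :=
  [set xi | exists2 k : nat, (1 <= k)%N & (A - s%:M) ^+ k *m xi = 0].

Definition is_ord (R : realType) (m : nat) (A : 'M[R]_m) (s : R)
    (xi : 'cV[R]_m) (k : nat) : Prop :=
  [/\ (1 <= k)%N, (A - s%:M) ^+ k *m xi = 0 &
    forall j : nat, (1 <= j)%N -> (A - s%:M) ^+ j *m xi = 0 -> (k <= j)%N].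

Definition is_cord (R : realType) (m : nat) (A : 'M[R]_m) (s : R) (nu : nat) :
  Prop :=
  (exists xi : 'cV[R]_m, [/\ xi <> 0, GEspace A s xi & is_ord A s xi nu]) /\
  (forall (xi : 'cV[R]_m) (k : nat),
    xi <> 0 -> GEspace A s xi -> is_ord A s xi k -> (k <= nu)%N).

Definition dominant_eigenvector (R : realType) (m : nat) (A : 'M[R]_m) (s : R)
    (w : 'cV[R]_m) : Prop :=
  exists nu : nat, is_cord A s nu /\
  [/\ w <> 0, Espace A s w &
    exists2 xi : 'cV[R]_m, GEspace A s xi & w = (A - s%:M) ^+ nu.-1 *m xi].

Definition linspan (R : realType) (m : nat) (S : set 'cV[R]_m) :
  set 'cV[R]_m :=
  [set x | exists n : nat, exists c : 'I_n -> R, exists u : 'I_n -> 'cV[R]_m,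
    (forall j : 'I_n, S (u j)) /\ x = \sum_(j < n) c j *: u j].

Definition DEspace (R : realType) (m : nat) (A : 'M[R]_m) (s : R) :
  set 'cV[R]_m := linspan [set w | dominant_eigenvector A s w].

(* Main.v *)
(* Bezout for char_poly A = (X - s)^k q splits e^{tA} into e^{tA} P and
   e^{tA} (1 - P), with P the projection onto GE_s along ker q(A). The first
   part is e^{st} times a polynomial in t whose leading term is
   t^p / p! D, where p = nu - 1 and D = (A - s)^p P has range DE_s; the second
   one is O(e^{(s - delta) t}). Hence p! t^{-p} e^{-st} X(t) = D V + O(1/t), with
   V the matrix of the v_i, and normalizing in the Frobenius norm gives
   X / |X| -> D V / |D V|, with error O(1/t). Since (A - s) D = 0, the Rayleigh
   quotient minus s is <(A - s) (X / |X| - D V / |D V|), X / |X|>, again O(1/t). *)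
Require Import Defs.
From mathcomp Require Import all_boot all_order all_algebra.
From mathcomp Require Import all_classical all_reals all_analysis.
From mathcomp Require Import ring lra.

Import Order.TTheory GRing.Theory Num.Theory.
Import numFieldNormedType.Exports.
Local Open Scope classical_set_scope.
Local Open Scope complex_scope.
Local Open Scope ring_scope.

(** * Frobenius norm *)

(** The trace form tr(X^T Y), rectangular so that columns and square matrices share one
    Cauchy-Schwarz inequality. *)
Definition mxdot {R : realType} {m n : nat} (X Y : 'M[R]_(m, n)) : R :=
  \sum_i \sum_j X i j * Y i j.

Definition fro {R : realType} {m n : nat} (X : 'M[R]_(m, n)) : R :=
  Num.sqrt (mxdot X X).

Lemma mxdotC {R : realType} {m n : nat} (X Y : 'M[R]_(m, n)) :
  mxdot X Y = mxdot Y X.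
Proof. by apply: eq_bigr => i _; apply: eq_bigr => j _; rewrite mulrC. Qed.

Lemma mxdotDl {R : realType} {m n : nat} (X Y Z : 'M[R]_(m, n)) :
  mxdot (X + Y) Z = mxdot X Z + mxdot Y Z.
Proof.
rewrite -big_split; apply: eq_bigr => i _; rewrite -big_split.
by apply: eq_bigr => j _; rewrite mxE mulrDl.
Qed.

Lemma mxdotZl {R : realType} {m n : nat} (c : R) (X Y : 'M[R]_(m, n)) :
  mxdot (c *: X) Y = c * mxdot X Y.
Proof.
rewrite mulr_sumr; apply: eq_bigr => i _; rewrite mulr_sumr.
by apply: eq_bigr => j _; rewrite mxE mulrA.
Qed.

Lemma mxdotNl {R : realType} {m n : nat} (X Y : 'M[R]_(m, n)) :
  mxdot (- X) Y = - mxdot X Y.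
Proof. by rewrite -scaleN1r mxdotZl mulN1r. Qed.

Lemma mxdotDr {R : realType} {m n : nat} (X Y Z : 'M[R]_(m, n)) :
  mxdot X (Y + Z) = mxdot X Y + mxdot X Z.
Proof. by rewrite mxdotC mxdotDl !(mxdotC X). Qed.

Lemma mxdotZr {R : realType} {m n : nat} (c : R) (X Y : 'M[R]_(m, n)) :
  mxdot X (c *: Y) = c * mxdot X Y.
Proof. by rewrite mxdotC mxdotZl mxdotC. Qed.

Lemma mxdotNr {R : realType} {m n : nat} (X Y : 'M[R]_(m, n)) :
  mxdot X (- Y) = - mxdot X Y.
Proof. by rewrite mxdotC mxdotNl mxdotC. Qed.

Lemma mxdot_ge0 {R : realType} {m n : nat} (X : 'M[R]_(m, n)) : 0 <= mxdot X X.
Proof. by apply: sumr_ge0 => i _; apply: sumr_ge0 => j _; rewrite -expr2 sqr_ge0. Qed.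

Lemma fro_ge0 {R : realType} {m n : nat} (X : 'M[R]_(m, n)) : 0 <= fro X.
Proof. exact: sqrtr_ge0. Qed.

Lemma sqr_fro {R : realType} {m n : nat} (X : 'M[R]_(m, n)) :
  fro X ^+ 2 = mxdot X X.
Proof. by rewrite sqr_sqrtr ?mxdot_ge0. Qed.

Lemma abs_entry_le_fro {R : realType} {m n : nat} (X : 'M[R]_(m, n)) i j :
  `|X i j| <= fro X.
Proof.
rewrite -sqrtr_sqr ler_wsqrtr// /mxdot (bigD1 i)//= (bigD1 j)//= expr2 -addrA lerDl.
rewrite addr_ge0//; first by apply: sumr_ge0 => k _; rewrite -expr2 sqr_ge0.
by apply: sumr_ge0 => k _; apply: sumr_ge0 => l _; rewrite -expr2 sqr_ge0.
Qed.

Lemma fro_eq0 {R : realType} {m n : nat} (X : 'M[R]_(m, n)) :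
  (fro X == 0) = (X == 0).
Proof.
apply/eqP/eqP => [X0|->]; last first.
  rewrite /fro /mxdot big1 ?sqrtr0// => i _.
  by rewrite big1// => j _; rewrite mxE mul0r.
apply/matrixP => i j; rewrite mxE; apply/eqP.
by rewrite -normr_le0 -X0 abs_entry_le_fro.
Qed.

(** With a, b, c as named below, |c X - b Y|^2 = c (a c - b^2) is nonnegative; c = 0 forces Y =
    0. *)
Lemma mxdot_cauchy_schwarz {R : realType} {m n : nat} (X Y : 'M[R]_(m, n)) :
  mxdot X Y ^+ 2 <= mxdot X X * mxdot Y Y.
Proof.
set a := mxdot X X; set b := mxdot X Y; set c := mxdot Y Y.
have [c0|cN0] := eqVneq c 0.
  have /eqP Y0 : Y == 0 by rewrite -fro_eq0 /fro -/c c0 sqrtr0.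
  have -> : b = 0 by rewrite /b Y0 -(scale0r (0 : 'M[R]_(m, n))) mxdotZr mul0r.
  by rewrite c0 mulr0 expr0n.
have c_gt0 : 0 < c by rewrite lt_def cN0 mxdot_ge0.
have := mxdot_ge0 (c *: X - b *: Y).
rewrite !(mxdotDl, mxdotDr, mxdotNl, mxdotNr, mxdotZl, mxdotZr) (mxdotC Y X).
rewrite -/a -/b -/c => h.
have : 0 <= c * (a * c - b ^+ 2) by nra.
by rewrite pmulr_rge0// subr_ge0.
Qed.

Lemma abs_mxdot_le {R : realType} {m n : nat} (X Y : 'M[R]_(m, n)) :
  `|mxdot X Y| <= fro X * fro Y.
Proof.
rewrite -sqrtrM ?mxdot_ge0// -sqrtr_sqr ler_wsqrtr//.
exact: mxdot_cauchy_schwarz.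
Qed.

Lemma froZ {R : realType} {m n : nat} (c : R) (X : 'M[R]_(m, n)) :
  fro (c *: X) = `|c| * fro X.
Proof.
by rewrite /fro mxdotZl mxdotZr mulrA -expr2 sqrtrM ?sqr_ge0// sqrtr_sqr.
Qed.

Lemma froN {R : realType} {m n : nat} (X : 'M[R]_(m, n)) : fro (- X) = fro X.
Proof. by rewrite -scaleN1r froZ normrN1 mul1r. Qed.

Lemma fro0 {R : realType} {m n : nat} : fro (0 : 'M[R]_(m, n)) = 0.
Proof. by apply/eqP; rewrite fro_eq0. Qed.

Lemma fro_triangle {R : realType} {m n : nat} (X Y : 'M[R]_(m, n)) :
  fro (X + Y) <= fro X + fro Y.
Proof.
have /ger0_norm <- : 0 <= fro X + fro Y by rewrite addr_ge0 ?fro_ge0.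
rewrite -sqrtr_sqr ler_wsqrtr// sqrrD !sqr_fro !(mxdotDl, mxdotDr) (mxdotC Y X).
have := le_trans (ler_norm _) (abs_mxdot_le X Y); lra.
Qed.

Lemma fro_sum {R : realType} {m n : nat} {I : Type} (s : seq I) (P : pred I)
    (F : I -> 'M[R]_(m, n)) :
  fro (\sum_(i <- s | P i) F i) <= \sum_(i <- s | P i) fro (F i).
Proof.
elim/big_rec2: _ => [|i x y _ le_xy]; first by rewrite fro0.
by apply: le_trans (fro_triangle _ _) _; rewrite lerD2l.
Qed.

Lemma fro_reverse_triangle {R : realType} {m n : nat} (X Y : 'M[R]_(m, n)) :
  `|fro X - fro Y| <= fro (X - Y).
Proof.
rewrite ler_norml; apply/andP; split.
  have := fro_triangle X (Y - X); rewrite addrC subrK -opprB froN; lra.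
by have := fro_triangle Y (X - Y); rewrite addrC subrK; lra.
Qed.

(** Each entry of the product pairs a row of X with a column of Y, so Cauchy-Schwarz applies entry
    by entry. *)
Lemma fro_mulmx {R : realType} {m n p : nat}
    (X : 'M[R]_(m, n)) (Y : 'M[R]_(n, p)) :
  fro (X *m Y) <= fro X * fro Y.
Proof.
rewrite -sqrtrM ?mxdot_ge0// ler_wsqrtr// {1}/mxdot.
have -> : mxdot X X * mxdot Y Y =
    \sum_i \sum_j (\sum_k X i k * X i k) * (\sum_k Y k j * Y k j).
  rewrite /mxdot [in X in _ * X]exchange_big /= mulr_suml.
  by apply: eq_bigr => i _; rewrite mulr_sumr.
apply: ler_sum => i _; apply: ler_sum => j _; rewrite -expr2.
rewrite [X in X ^+ 2](_ : _ = mxdot (row i X) (col j Y)^T).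
  apply: le_trans (mxdot_cauchy_schwarz _ _) _; rewrite /mxdot !big_ord1.
  rewrite le_eqVlt; apply/orP; left; apply/eqP.
  by congr (_ * _); apply: eq_bigr => k _; rewrite !mxE.
by rewrite mxE /mxdot big_ord1; apply: eq_bigr => k _; rewrite !mxE.
Qed.

(* No hypothesis on X: for X = 0 the left-hand side is 1 and the bound is 2. *)
Lemma normalize_dist {R : realType} {m n : nat} (X Y : 'M[R]_(m, n)) :
  Y != 0 ->
  fro ((fro X)^-1 *: X - (fro Y)^-1 *: Y) <= 2 * (fro Y)^-1 * fro (X - Y).
Proof.
rewrite -fro_eq0 => Y0.
have Yp : 0 < fro Y by rewrite lt_def Y0 fro_ge0.
have -> : (fro X)^-1 *: X - (fro Y)^-1 *: Y =
    (fro Y)^-1 *: (X - Y) + ((fro X)^-1 - (fro Y)^-1) *: X.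
  rewrite scalerBr scalerBl; apply/matrixP => i j; rewrite !mxE; ring.
apply: le_trans (fro_triangle _ _) _; rewrite !froZ ger0_norm ?invr_ge0 ?fro_ge0//.
(* The first summand uses half of the bound; the second has norm ||Y| - |X|| / |Y| for X nonzero and
   uses the other half. *)
suff : `|(fro X)^-1 - (fro Y)^-1| * fro X <= (fro Y)^-1 * fro (X - Y) by lra.
have [->|X0] := eqVneq X 0.
  by rewrite fro0 mulr0 mulr_ge0 ?invr_ge0 ?fro_ge0.
have Xp : 0 < fro X by rewrite lt_def fro_eq0 X0 fro_ge0.
rewrite -{2}(ger0_norm (fro_ge0 X)) -normrM.
have -> : ((fro X)^-1 - (fro Y)^-1) * fro X = (fro Y)^-1 * (fro Y - fro X).
  by field; rewrite !gt_eqF.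
rewrite normrM ger0_norm ?invr_ge0 ?fro_ge0// ler_wpM2l ?invr_ge0 ?fro_ge0//.
by rewrite distrC fro_reverse_triangle.
Qed.

Lemma norm2E {R : realType} {m : nat} (u : 'cV[R]_m) : norm2 u = fro u.
Proof.
by rewrite /norm2 /fro /mxdot; congr Num.sqrt; apply: eq_bigr => i _; rewrite big_ord1.
Qed.

Lemma norm2_col_le {R : realType} {m : nat} (X : 'M[R]_m) (i : 'I_m) :
  norm2 (col i X) <= fro X.
Proof.
rewrite norm2E ler_wsqrtr//.
have -> : mxdot (col i X) (col i X) = \sum_k X k i * X k i.
  by apply: eq_bigr => k _; rewrite big_ord1 mxE.
rewrite [leRHS](_ : _ = \sum_j \sum_k X k j * X k j); last first.
  by rewrite /mxdot exchange_big.
rewrite [leRHS](bigD1 i)//= lerDl.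
by do 2 (apply: sumr_ge0 => ? _); rewrite -expr2 sqr_ge0.
Qed.

Lemma mxnorm2E {R : realType} {m : nat} (X : 'M[R]_m) : mxnorm2 X = fro X.
Proof.
rewrite /mxnorm2 /fro; congr Num.sqrt.
rewrite [RHS](_ : _ = \sum_j \sum_i X i j * X i j); last first.
  by rewrite /mxdot exchange_big.
apply: eq_bigr => i _; rewrite norm2E sqr_fro; apply: eq_bigr => j _.
by rewrite big_ord1 mxE.
Qed.

(** * The matrix exponential as an entrywise power series *)

Lemma is_derive_bigsum {R : realType} {I : Type} (s : seq I) (f : I -> R -> R)
    (df : I -> R) (x : R) :
  (forall i, is_derive x (1 : R) (f i) (df i)) ->
  is_derive x (1 : R) (fun t => \sum_(i <- s) f i t) (\sum_(i <- s) df i).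
Proof.
move=> fdf; elim: s => [|i s IHs].
  rewrite big_nil (_ : (fun _ => _) = cst 0); first exact: is_derive_cst.
  by apply/funext => t; rewrite big_nil.
rewrite big_cons (_ : (fun _ => _) = f i + (fun t => \sum_(i <- s) f i t)).
  exact: is_deriveD.
by apply/funext => t; rewrite big_cons.
Qed.

Lemma cvg_bigsum {R : realType} {I : Type} (s : seq I) (u : I -> nat -> R)
    (l : I -> R) :
  (forall i, u i @ \oo --> l i) ->
  (fun n => \sum_(i <- s) u i n) @ \oo --> \sum_(i <- s) l i.
Proof.
move=> ul; elim: s => [|i s IHs].
  rewrite big_nil (_ : (fun _ => _) = cst 0); first exact: cvg_cst.
  by apply/funext => t; rewrite big_nil.
rewrite big_cons (_ : (fun _ => _) = u i + (fun n => \sum_(i <- s) u i n)).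
  exact: cvgD.
by apply/funext => t; rewrite big_cons.
Qed.

(** The norm here is the maximum of the entries, and finitely many eventual bounds hold
    simultaneously. *)
Lemma cvg_mx_entries {R : realType} {m n : nat} (u : nat -> 'M[R]_(m, n))
    (L : 'M[R]_(m, n)) :
  (forall i j, (fun k => u k i j) @ \oo --> L i j) -> u @ \oo --> L.
Proof.
move=> uL; apply/cvgrPdist_lt => e e0.
have H : \forall k \near \oo, forall i j, `|L i j - u k i j| < e.
  apply: filter_forall => i; apply: filter_forall => j.
  by have /cvgrPdist_lt := uL i j; apply.
apply: filterS H => k Hk; rewrite /Num.norm /= mx_normrE.
by apply/bigmax_ltP; split => //= -[i j] _ /=; rewrite !mxE.
Qed.

(** Comparison with M times the exponential series at r |x|. *)
Lemma is_cvg_pseries_fact {R : realType} (c : nat -> R) (M r x : R) :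
  (forall k, `|c k| <= M * r ^+ k / k`!%:R) -> 0 <= M -> 0 <= r ->
  cvgn (pseries c x).
Proof.
move=> cM M0 r0; apply: normed_cvg.
have := @is_cvg_seriesZ _ _ M (is_cvg_series_exp_coeff (r * `|x|)).
apply: series_le_cvg => k /=; first exact: normr_ge0.
  by rewrite /GRing.scale /= mulr_ge0 // /exp_coeff /= mulr_ge0// exprn_ge0// mulr_ge0.
rewrite normrM normrX [leRHS](_ : _ = M * r ^+ k / k`!%:R * `|x| ^+ k).
  by rewrite ler_wpM2r// exprn_ge0.
by rewrite [LHS](_ : _ = M * ((r * `|x|) ^+ k / k`!%:R))// exprMn; ring.
Qed.

(** Power series coefficients in t of an entry of e^{tA} B. Carrying B along closes the family under
    differentiation, which turns B into A B. *)
Definition expmx_coef {R : realType} {m n : nat} (A : 'M[R]_m)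
    (B : 'M[R]_(m, n)) (i : 'I_m) (j : 'I_n) (k : nat) : R :=
  (k`!%:R)^-1 * (A ^+ k *m B) i j.

(** The factor [fro 1] starts the induction: the Frobenius norm of the identity is not 1 in
    general. *)
Lemma fro_exprn_le {R : realType} {m : nat} (A : 'M[R]_m) (k : nat) :
  fro (A ^+ k) <= fro (1 : 'M[R]_m) * fro A ^+ k.
Proof.
elim: k => [|k IHk]; first by rewrite !expr0 mulr1.
rewrite !exprSr mulrA; apply: le_trans (fro_mulmx _ _) _.
by rewrite ler_wpM2r ?fro_ge0.
Qed.

Lemma is_cvg_expmx_coef {R : realType} {m n : nat} (A : 'M[R]_m)
    (B : 'M[R]_(m, n)) i j (x : R) :
  cvgn (pseries (expmx_coef A B i j) x).
Proof.
apply: (@is_cvg_pseries_fact _ _ (fro (1 : 'M[R]_m) * fro B) (fro A));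
  rewrite ?mulr_ge0 ?fro_ge0// => k.
rewrite /expmx_coef normrM ger0_norm ?invr_ge0// mulrC ler_wpM2r ?invr_ge0//.
apply: le_trans (abs_entry_le_fro _ _ _) _; apply: le_trans (fro_mulmx _ _) _.
by rewrite mulrAC ler_wpM2r ?fro_ge0// fro_exprn_le.
Qed.

Lemma pseries_diffs_expmx_coef {R : realType} {m n : nat} (A : 'M[R]_m)
    (B : 'M[R]_(m, n)) i j :
  pseries_diffs (expmx_coef A B i j) = expmx_coef A (A *m B) i j.
Proof.
apply/funext => k; rewrite /pseries_diffs /expmx_coef factS natrM invfM mulrA.
by rewrite mulVKf ?pnatr_eq0// exprSr -mulmxA.
Qed.

Lemma scalemx_exprn {R : realType} {m : nat} (A : 'M[R]_m) (t : R) (k : nat) :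
  (t *: A) ^+ k = t ^+ k *: A ^+ k.
Proof.
elim: k => [|k IHk]; first by rewrite !expr0 scale1r.
rewrite !exprS IHk -[LHS]/((t *: A) *m (t ^+ k *: A ^+ k)).
by rewrite -scalemxAl -scalemxAr scalerA.
Qed.

Lemma expmxE {R : realType} {m : nat} (A : 'M[R]_m) (t : R) :
  expmx (t *: A) = \matrix_(i, j) limn (pseries (expmx_coef A 1 i j) t).
Proof.
apply/(@cvg_lim 'M[R]_m) => //; apply: cvg_mx_entries => i j; rewrite mxE.
rewrite (_ : (fun _ => _) = pseries (expmx_coef A 1 i j) t).
  exact: is_cvg_expmx_coef.
apply/funext => n; rewrite /pseries /series /= summxE; apply: eq_bigr => k _.
by rewrite /expmx_coef scalemx_exprn mulmx1 !mxE; ring.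
Qed.

Lemma expmx_mulmxE {R : realType} {m n : nat} (A : 'M[R]_m)
    (B : 'M[R]_(m, n)) (t : R) i j :
  (expmx (t *: A) *m B) i j = limn (pseries (expmx_coef A B i j) t).
Proof.
rewrite mxE expmxE; apply/esym/(@cvg_lim R) => //.
rewrite (_ : pseries _ _ = fun n => \sum_k pseries (expmx_coef A 1 i k) t n * B k j).
  apply: cvg_bigsum => k; rewrite mxE; apply: cvgMl.
  exact: is_cvg_expmx_coef.
apply/funext => N; rewrite /pseries /series /=.
under [RHS]eq_bigr do rewrite mulr_suml.
rewrite exchange_big; apply: eq_bigr => l _ /=; rewrite /expmx_coef !mxE.
rewrite mulr_sumr mulr_suml; apply: eq_bigr => k _; rewrite mulmx1; ring.
Qed.

Lemma is_derive_expmx {R : realType} {m n : nat} (A : 'M[R]_m)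
    (B : 'M[R]_(m, n)) (t : R) i j :
  is_derive t (1 : R) (fun t => (expmx (t *: A) *m B) i j)
    ((expmx (t *: A) *m (A *m B)) i j).
Proof.
rewrite expmx_mulmxE (_ : (fun _ => _) =
    fun t => limn (pseries (expmx_coef A B i j) t)); last first.
  by apply/funext => u; rewrite expmx_mulmxE.
rewrite -pseries_diffs_expmx_coef.
(* Termwise differentiation asks for convergence of the series and its first two derived series at a
   point beyond |t|; |t| + 1 is one. *)
apply: (@pseries_snd_diffs _ _ (`|t| + 1)); rewrite ?pseries_diffs_expmx_coef.
1-3: exact: is_cvg_expmx_coef.
by rewrite [ltRHS]ger0_norm// ltrDl.
Qed.

Lemma expmx0 {R : realType} {m : nat} : expmx (0 : 'M[R]_m) = 1.
Proof.
rewrite -[in LHS](scale0r 0) expmxE; apply/matrixP => i j; rewrite mxE.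
apply/(@cvg_lim R) => //.
(* After the shift every partial sum contains the k = 0 term, the only nonzero one. *)
rewrite -cvg_shiftS; apply: cvg_near_cst; near=> n.
rewrite /pseries /series /= big_nat_recl// big1 ?addr0.
  by rewrite /expmx_coef fact0 invr1 mul1r expr0 mulmx1 expr0 mulr1.
by move=> k _; rewrite exprS mul0r mulr0.
Unshelve. all: by end_near. Qed.

(** * Growth of the exponential on generalized eigenspaces *)

(** This is |e X - Y|^2 >= 0 divided by e. *)
Lemma mxdot_young {R : realType} {m n : nat} (X Y : 'M[R]_(m, n)) (e : R) :
  0 < e -> 2 * mxdot X Y <= e * mxdot X X + e^-1 * mxdot Y Y.
Proof.
move=> e0; have := mxdot_ge0 (e *: X - Y).
rewrite !(mxdotDl, mxdotDr, mxdotNl, mxdotNr, mxdotZl, mxdotZr) (mxdotC Y X) => h.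
rewrite -(ler_pM2l e0) mulrDr !mulrA mulfV ?gt_eqF// mul1r; lra.
Qed.

Lemma is_derive_expR_scale {R : realType} (c x : R) :
  is_derive x (1 : R) (fun t => expR (c * t)) (c * expR (c * x)).
Proof.
have h : is_derive x (1 : R) (fun t : R => c * t) c.
  rewrite -[X in is_derive _ _ _ X]mulr1.
  exact: (@is_deriveZ _ _ _ id c x 1 1).
by have := is_derive1_comp (is_derive_expR (c * x)) h; rewrite mulrC.
Qed.

(** With C = |f(0)| + K / (b - a), the function e^{-at} f(t) - C e^{(b-a)t} is nonincreasing on t >=
    0 because C (b - a) >= K, and it starts at or below 0 because C >= f(0). *)
Lemma gronwall_expR {R : realType} (f df : R -> R) (a b K : R) :
  (forall t : R, is_derive t (1 : R) f (df t)) ->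
  (forall t : R, 0 <= t -> df t <= a * f t + K * expR (b * t)) ->
  a < b -> 0 <= K ->
  forall t : R, 0 <= t -> f t <= (`|f 0| + K / (b - a)) * expR (b * t).
Proof.
move=> fdf dfle ab K0 t t0; set C := (X in X * _).
have ba0 : 0 < b - a by rewrite subr_gt0.
pose g u := f u * expR (- a * u) - C * expR ((b - a) * u).
pose dg u := (df u - a * f u) * expR (- a * u)
             - C * (b - a) * expR ((b - a) * u).
have gdg u : is_derive u (1 : R) g (dg u).
  have h1 := is_deriveM (fdf u) (is_derive_expR_scale (- a) u).
  have h2 := @is_deriveZ _ _ _ _ C _ _ _ (is_derive_expR_scale (b - a) u).
  apply: (is_derive_eq (is_deriveB h1 h2)).
  by rewrite /dg /GRing.scale /=; ring.
have dg_le0 u : 0 <= u -> dg u <= 0.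
  move=> u0; rewrite /dg subr_le0.
  have -> : expR ((b - a) * u) = expR (b * u) * expR (- a * u).
    by rewrite -expRD; congr expR; ring.
  rewrite mulrA ler_wpM2r ?expR_ge0//.
  apply: (@le_trans _ _ (K * expR (b * u))).
    by rewrite lerBlDl dfle.
  rewrite ler_wpM2r ?expR_ge0// /C mulrDl divfK ?gt_eqF// lerDr.
  by rewrite mulr_ge0// ltW.
have gle : g t <= g 0.
  apply: (@ler0_derive1_le_cc _ g 0 t) => //.
  - move=> x; rewrite in_itv/= derive1E => /andP[x0 _].
    by have [_ ->] := gdg x; rewrite dg_le0// ltW.
  - by apply: derivable_within_continuous => x _; case: (gdg x).
  - by rewrite in_itv/= lexx t0.
  - by rewrite in_itv/= lexx t0.
have g0 : g 0 <= 0.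
  rewrite /g !mulr0 expR0 !mulr1 subr_le0 /C.
  by rewrite (le_trans (ler_norm _))// lerDl divr_ge0// ltW.
have : f t * expR (- a * t) <= C * expR ((b - a) * t).
  by rewrite -subr_le0; exact: le_trans gle g0.
rewrite -(ler_pM2r (expR_gt0 (a * t))) -!mulrA -!expRD.
have -> : - a * t + a * t = 0 by ring.
have -> : (b - a) * t + a * t = b * t by ring.
by rewrite expR0 mulr1.
Qed.

Lemma is_derive_mxdot_expmx {R : realType} {m n : nat} (A : 'M[R]_m)
    (B : 'M[R]_(m, n)) (t : R) :
  is_derive t (1 : R) (fun t => mxdot (expmx (t *: A) *m B) (expmx (t *: A) *m B))
    (2 * mxdot (expmx (t *: A) *m B) (expmx (t *: A) *m (A *m B))).
Proof.
rewrite [X in is_derive _ _ _ X](_ : _ =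
  \sum_i \sum_j 2 * ((expmx (t *: A) *m B) i j *
     (expmx (t *: A) *m (A *m B)) i j)); last first.
  rewrite mulr_sumr; apply: eq_bigr => i _; rewrite mulr_sumr.
  exact: eq_bigr.
apply: is_derive_bigsum => i; apply: is_derive_bigsum => j.
have h := is_derive_expmx A B t i j.
apply: (is_derive_eq (is_deriveM h h)).
by rewrite /GRing.scale /=; ring.
Qed.

Lemma complex_Re_sum {R : realType} {I : Type} (s : seq I) (F : I -> R[i]) :
  complex.Re (\sum_(i <- s) F i) = \sum_(i <- s) complex.Re (F i).
Proof. by apply: (big_morph (@complex.Re R)) => // -[? ?] []. Qed.

Lemma complex_Im_sum {R : realType} {I : Type} (s : seq I) (F : I -> R[i]) :
  complex.Im (\sum_(i <- s) F i) = \sum_(i <- s) complex.Im (F i).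
Proof. by apply: (big_morph (@complex.Im R)) => // -[? ?] []. Qed.

(** Real part of A H = (A - z) H + z H; it lets the real exponential act on complex data. *)
Lemma map_Re_mul_shift {R : realType} {m n : nat} (A : 'M[R]_m) (z : R[i])
    (H : 'M[R[i]]_(m, n)) :
  A *m map_mx (@complex.Re R) H =
    map_mx (@complex.Re R) ((map_mx (real_complex R) A - z%:M) *m H)
    + (complex.Re z *: map_mx (@complex.Re R) H
       - complex.Im z *: map_mx (@complex.Im R) H).
Proof.
apply/matrixP => i j; rewrite mulmxBl mul_scalar_mx !mxE.
have -> (x y : R[i]) : complex.Re (x - y) = complex.Re x - complex.Re y.
  by case: x y => ? ? [].
rewrite complex_Re_sum [X in _ = _ - X + _](_ : _ =
  complex.Re z * complex.Re (H i j) - complex.Im z * complex.Im (H i j)).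
  rewrite subrK; apply: eq_bigr => k _; rewrite !mxE.
  by case: (H k j) => x y /=; rewrite mul0r subr0.
by case: z (H i j) => [a b] [c d].
Qed.

Lemma map_Im_mul_shift {R : realType} {m n : nat} (A : 'M[R]_m) (z : R[i])
    (H : 'M[R[i]]_(m, n)) :
  A *m map_mx (@complex.Im R) H =
    map_mx (@complex.Im R) ((map_mx (real_complex R) A - z%:M) *m H)
    + (complex.Re z *: map_mx (@complex.Im R) H
       + complex.Im z *: map_mx (@complex.Re R) H).
Proof.
apply/matrixP => i j; rewrite mulmxBl mul_scalar_mx !mxE.
have -> (x y : R[i]) : complex.Im (x - y) = complex.Im x - complex.Im y.
  by case: x y => ? ? [].
rewrite complex_Im_sum [X in _ = _ - X + _](_ : _ =
  complex.Re z * complex.Im (H i j) + complex.Im z * complex.Re (H i j)).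
  rewrite subrK; apply: eq_bigr => k _; rewrite !mxE.
  by case: (H k j) => x y /=; rewrite mul0r addr0.
by case: z (H i j) => [a b] [c d].
Qed.

(* By induction on the roots: with u = e^{tA} H one has u' = z u + e^{tA} H',
   where H' = (A - z) H is killed by one factor less, so that Gronwall applies
   to |u|^2. *)
Lemma expmx_decay {R : realType} {m n : nat} (A : 'M[R]_m.+1) (r : R)
    (zs : seq R[i]) (H : 'M[R[i]]_(m.+1, n)) :
  (forall z, z \in zs -> complex.Re z < r) ->
  horner_mx (map_mx (real_complex R) A) (\prod_(z <- zs) ('X - z%:P)) *m H = 0 ->
  exists2 C : R, 0 <= C & forall t : R, 0 <= t ->
    fro (expmx (t *: A) *m map_mx (@complex.Re R) H) ^+ 2
    + fro (expmx (t *: A) *m map_mx (@complex.Im R) H) ^+ 2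
    <= C * expR (2 * r * t).
Proof.
set Ac := map_mx _ A.
elim: zs H => [|z zs IHzs] H zsr.
  rewrite big_nil rmorph1 mul1mx => ->; exists 0 => // t t0.
  have Re0 : map_mx (@complex.Re R) (0 : 'M[R[i]]_(m.+1, n)) = 0.
    by apply/matrixP => i j; rewrite !mxE.
  have Im0 : map_mx (@complex.Im R) (0 : 'M[R[i]]_(m.+1, n)) = 0.
    by apply/matrixP => i j; rewrite !mxE.
  by rewrite Re0 Im0 mulmx0 fro0 expr0n addr0 mul0r.
rewrite big_cons mulrC rmorphM rmorphB /= horner_mx_X horner_mx_C => qH.
pose H' := (Ac - z%:M) *m H.
have [C C0 IH] : exists2 C : R, 0 <= C & forall t : R, 0 <= t ->
    fro (expmx (t *: A) *m map_mx (@complex.Re R) H') ^+ 2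
    + fro (expmx (t *: A) *m map_mx (@complex.Im R) H') ^+ 2
    <= C * expR (2 * r * t).
  apply: IHzs; first by move=> w wzs; rewrite zsr// inE wzs orbT.
  by rewrite /H' mulmxA.
have zr : complex.Re z < r by rewrite zsr// inE eqxx.
pose e := r - complex.Re z.
have e0 : 0 < e by rewrite subr_gt0.
pose U t := expmx (t *: A) *m map_mx (@complex.Re R) H.
pose V t := expmx (t *: A) *m map_mx (@complex.Im R) H.
pose f t := mxdot (U t) (U t) + mxdot (V t) (V t).
pose df t := 2 * mxdot (U t) (expmx (t *: A) *m (A *m map_mx (@complex.Re R) H))
  + 2 * mxdot (V t) (expmx (t *: A) *m (A *m map_mx (@complex.Im R) H)).
have e0' : 0 < 2 * r - (2 * r - e) by rewrite subKr.
exists (`|f 0| + e^-1 * C / (2 * r - (2 * r - e))).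
  by rewrite addr_ge0 ?normr_ge0 ?divr_ge0 ?mulr_ge0 ?invr_ge0 ?(ltW e0) ?(ltW e0').
move=> t t0; rewrite !sqr_fro.
(* The growth rate 2 Re z = 2 r - 2 e of |u|^2 rises by e through Young's inequality and stays below
   2 r; the Im z terms cancel between U and V. *)
apply: (@gronwall_expR _ f df (2 * r - e)) => //.
- move=> u; exact: is_deriveD (is_derive_mxdot_expmx _ _ _)
    (is_derive_mxdot_expmx _ _ _).
- move=> u u0; rewrite /df (map_Re_mul_shift A z) (map_Im_mul_shift A z) -/Ac -/H'.
  have := IH u u0; rewrite !sqr_fro -(ler_pM2l (_ : 0 < e^-1)) ?invr_gt0//.
  have := mxdot_young (U u) (expmx (u *: A) *m map_mx (@complex.Re R) H') e e0.
  have := mxdot_young (V u) (expmx (u *: A) *m map_mx (@complex.Im R) H') e e0.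
  rewrite !(mulmxDr, mulmxN, =^~ scalemxAr) -/(U u) -/(V u).
  rewrite !(mxdotDr, mxdotNr, mxdotZr) (mxdotC (V u) (U u)) /f.
  set uu := mxdot (U u) (U u); set vv := mxdot (V u) (V u).
  set x := mxdot (U u) (_ *m _); set y := mxdot (V u) (_ *m _).
  set x' := mxdot (_ *m _) _; set y' := mxdot (_ *m _) _.
  set uv := mxdot (U u) (V u).
  have -> : complex.Re z = r - e by rewrite /e; ring.
  clearbody e; lra.
- by rewrite -subr_gt0.
- by rewrite mulr_ge0// invr_ge0 ltW.
Qed.

(** The series of e^{t(A - s)} stops on H. By induction on N: both sides agree at t = 0, and their
    derivatives agree by the previous case applied to (A - s) H. *)
Lemma expmx_nilpotent {R : realType} {m n : nat} (A : 'M[R]_m) (s : R) (N : nat)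
    (H : 'M[R]_(m, n)) (t : R) :
  (A - s%:M) ^+ N *m H = 0 ->
  expR (- s * t) *: (expmx (t *: A) *m H) =
    \sum_(k < N) (t ^+ k / k`!%:R) *: ((A - s%:M) ^+ k *m H).
Proof.
elim: N H t => [|N IHN] H t HN.
  by move: HN; rewrite expr0 mul1mx => ->; rewrite mulmx0 scaler0 big_ord0.
pose B := A - s%:M.
have {}IHN u := IHN (B *m H) u.
have HN' : B ^+ N *m (B *m H) = 0 by rewrite mulmxA -[_ *m B]exprSr.
apply/matrixP => i j; apply/eqP; rewrite -subr_eq0; apply/eqP.
pose f (u : R) := (expR (- s * u) *: (expmx (u *: A) *m H)) i j
  - (\sum_(k < N.+1) (u ^+ k / k`!%:R) *: (B ^+ k *m H)) i j.
rewrite -/(f t) (_ : f t = f 0); last apply: is_derive_0_is_cst => u.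
  rewrite /f mulr0 expR0 scale1r scale0r expmx0 mul1mx.
  rewrite big_ord_recl big1 ?addr0 => [|k _].
    by rewrite expr0 fact0 divr1 expr0 mul1mx scale1r subrr.
  by rewrite /bump /= exprS !mul0r scale0r.
have fE : f = (fun u => expR (- s * u) * (expmx (u *: A) *m H) i j)
  - (fun u => \sum_(k < N.+1) (B ^+ k *m H) i j / k`!%:R * u ^+ k).
  apply/funext => v; rewrite /f mxE summxE; congr (_ - _).
  by apply: eq_bigr => k _; rewrite mxE; ring.
rewrite fE.
have h1 := is_deriveM (is_derive_expR_scale (- s) u) (is_derive_expmx A H u i j).
have h2 : is_derive u (1 : R)
    (fun u => \sum_(k < N.+1) (B ^+ k *m H) i j / k`!%:R * u ^+ k)
    (\sum_(k < N.+1) (B ^+ k *m H) i j / k`!%:R * (k%:R * u ^+ k.-1)).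
  apply: is_derive_bigsum => k.
  have hX := @is_deriveX _ _ id k u (1 : R) _ (is_derive_id u 1).
  rewrite exprfctE in hX.
  apply: (is_derive_eq (@is_deriveZ _ _ _ _ _ _ _ _ hX)).
  by rewrite /GRing.scale /= mulr1.
apply: (is_derive_eq (is_deriveB h1 h2)).
have /matrixP/(_ i j) := IHN u HN'.
rewrite mxE summxE => E.
(* The k = 0 term has derivative 0; shifting the index turns (k + 1) / (k + 1)! into 1 / k! and
   yields the sum for (A - s) H. *)
rewrite [X in _ - X](_ : _ =
    \sum_(k < N) ((u ^+ k / k`!%:R) *: (B ^+ k *m (B *m H))) i j); last first.
  rewrite big_ord_recl mul0r mulr0 add0r; apply: eq_bigr => k _.
  rewrite lift0 /= exprSr -[B ^+ k * B]/(B ^+ k *m B) -mulmxA [RHS]mxE factS natrM.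
  have : k.+1%:R != 0 :> R by rewrite pnatr_eq0.
  have : k`!%:R != 0 :> R by rewrite pnatr_eq0 -lt0n fact_gt0.
  move: (_ *m _) => W; move: k.+1%:R k`!%:R => c d d0 c0.
  by field; rewrite c0 d0.
rewrite -E (_ : A *m H = B *m H + s *: H); last first.
  by rewrite mulmxBl mul_scalar_mx subrK.
rewrite mulmxDr -scalemxAr.
by rewrite !mxE /GRing.scale /=; ring.
Qed.

(** * Spectral projection and dominant eigenspace *)

Lemma char_poly_trmx {F : comNzRingType} {n : nat} (A : 'M[F]_n) :
  char_poly A^T = char_poly A.
Proof.
rewrite /char_poly -[RHS]det_tr; congr (\det _).
by apply/matrixP => i j; rewrite !mxE eq_sym.
Qed.

Lemma spectrum_root {R : realType} {m : nat} (A : 'M[R]_m) (mu : R[i]) :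
  spectrum A mu <-> root (map_poly (real_complex R) (char_poly A)) mu.
Proof.
by rewrite /spectrum /= eigenvalue_root_char char_poly_trmx map_char_poly.
Qed.

(** As s is real, it is already a root of the real characteristic polynomial, which provides a real
    eigenvector. *)
Lemma Espace_neq0 {R : realType} {m : nat} (A : 'M[R]_m) (s : R) :
  spectrum A s%:C -> exists2 w, w != 0 & Espace A s w.
Proof.
move/spectrum_root; rewrite fmorph_root -char_poly_trmx -eigenvalue_root_char.
move=> /eigenvalueP[u uA u0]; exists u^T.
  by apply: contra u0 => /eqP u0; rewrite -[u]trmxK u0 trmx0.
apply: trmx_inj; rewrite /Espace /= trmx_mul trmxK linearB /= tr_scalar_mx.
by rewrite mulmxBr uA mul_mx_scalar subrr trmx0.
Qed.

(* Bezout for the factors (X - s)^k and q of the characteristic polynomial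
   produces the projection P onto GE_s along ker q(A). *)
Lemma spectral_projection {R : realType} {m : nat} (A : 'M[R]_m.+1) (s r : R) :
  (forall mu, spectrum A mu -> mu <> s%:C -> complex.Re mu < r) ->
  exists P : 'M[R]_m.+1, [/\
    exists k, (A - s%:M) ^+ k *m P = 0,
    forall xi, GEspace A s xi -> P *m xi = xi &
    exists2 C : R, 0 <= C &
      forall t : R, 0 <= t -> fro (expmx (t *: A) *m (1 - P)) <= C * expR (r * t)].
Proof.
move=> gap.
(* n is the algebraic multiplicity of s, so q(s) is nonzero and q is coprime to all powers of X -
   s. *)
have [n [q qs chE]] := multiplicity_XsubC (char_poly A) s.
rewrite monic_neq0 ?char_poly_monic//= in qs.
have cop k : coprimep (('X - s%:P) ^+ k) q.
  by apply: coprimep_expl; rewrite coprimep_sym coprimep_XsubC.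
have hX k : horner_mx A (('X - s%:P) ^+ k) = (A - s%:M) ^+ k.
  by rewrite rmorphXn rmorphB /= horner_mx_X horner_mx_C.
have hch p : horner_mx A (p * char_poly A) = 0.
  by rewrite rmorphM /= Cayley_Hamilton mulr0.
have /Bezout_eq1_coprimepP[[a b] /= ab1] := cop n.
have QE : 1 - horner_mx A (b * q) = horner_mx A (a * ('X - s%:P) ^+ n).
  by rewrite -[1](rmorph1 (horner_mx A)) -ab1 rmorphD /= addrK.
(* P = (b q)(A) and 1 - P = (a (X - s)^n)(A). Multiplied by (X - s)^n and q respectively, both
   become multiples of the characteristic polynomial, so Cayley-Hamilton kills them. *)
exists (horner_mx A (b * q)); split.
- exists n; rewrite -hX -[_ *m _]/(_ * _) -rmorphM /=.
  by rewrite [X in horner_mx A X](_ : _ = b * char_poly A) ?hch// chE; ring.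
- move=> xi [k _ kxi]; apply/eqP; rewrite eq_sym -subr_eq0.
  rewrite -[X in X - _](mul1mx xi) -mulmxBl QE.
  (* Bezout at the exponent k that kills xi gives xi = (d q)(A) xi, and (1 - P) (d q)(A) = 0 by
     Cayley-Hamilton. *)
  have /Bezout_eq1_coprimepP[[c d] /= cd1] := cop k.
  have -> : xi = horner_mx A (d * q) *m xi.
    rewrite -[LHS]mul1mx -[1%:M](rmorph1 (horner_mx A)) -cd1 rmorphD /= mulmxDl.
    by rewrite rmorphM /= hX -[_ * _]/(_ *m _) -mulmxA kxi mulmx0 add0r.
  rewrite mulmxA -[X in X *m _]/(_ * _) -rmorphM /=.
  by rewrite [X in horner_mx A X](_ : _ = a * d * char_poly A) ?hch ?mul0mx// chE; ring.
- set Q := 1 - _.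
  (* Over the complex numbers q splits; its roots are eigenvalues other than s, hence have real part
     below r, and q(A) (1 - P) = 0, so [expmx_decay] applies. *)
  have [zs qE] := closed_field_poly_normal (map_poly (real_complex R) q).
  have q0 : q != 0 by apply: contraNneq qs => ->; exact: root0.
  have lc0 : lead_coef (map_poly (real_complex R) q) != 0.
    by rewrite lead_coef_eq0 map_poly_eq0.
  have [||C C0 HC] := @expmx_decay _ _ _ A r zs (map_mx (real_complex R) Q).
  + move=> z zzs.
    have qz : root (map_poly (real_complex R) q) z.
      by rewrite qE rootZ// root_prod_XsubC.
    apply: gap.
      by apply/spectrum_root; rewrite chE rmorphM rootM qz.
    by move=> zs'; move: qz; rewrite zs' fmorph_root; exact/negP.
  + apply/eqP; rewrite -(inj_eq (scalerI lc0)) scaler0; apply/eqP.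
    rewrite scalemxAl -horner_mxZ -qE -map_horner_mx -map_mxM.
    rewrite /Q QE -[X in map_mx _ X]/(_ * _) -rmorphM /=.
    by rewrite [X in horner_mx A X](_ : _ = a * char_poly A) ?hch ?map_mx0// chE; ring.
  + exists (Num.sqrt C); first exact: sqrtr_ge0.
    move=> t t0.
    have {HC} := HC t t0.
    rewrite (_ : map_mx (@complex.Re R) _ = Q); last first.
      by apply/matrixP => i j; rewrite !mxE.
    rewrite (_ : map_mx (@complex.Im R) _ = 0); last first.
      by apply/matrixP => i j; rewrite !mxE.
    rewrite mulmx0 fro0 expr0n addr0 => le.
    rewrite -(ler_pXn2r (_ : (0 < 2)%N))// ?nnegrE ?fro_ge0
      ?mulr_ge0 ?sqrtr_ge0 ?expR_ge0//.
    by rewrite exprMn (sqr_sqrtr C0) -expRM_natl (mulrA 2%:R).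
Qed.

Lemma is_cord_unique {R : realType} {m : nat} (A : 'M[R]_m) (s : R) (nu nu' : nat) :
  is_cord A s nu -> is_cord A s nu' -> nu = nu'.
Proof.
move=> [[xi [xi0 xiG xiO]] nu_max] [[xi' [xi'0 xi'G xi'O]] nu'_max].
by apply/eqP; rewrite eqn_leq (nu'_max xi)// (nu_max xi').
Qed.

(** P has range GE_s, so the cyclic order is p + 1 and the dominant eigenvectors are the nonzero
    values of (A - s)^p P. *)
Lemma DEspace_projection {R : realType} {m : nat} (A P : 'M[R]_m) (s : R) (p : nat) :
  (forall xi, GEspace A s xi -> P *m xi = xi) ->
  (A - s%:M) ^+ p *m P != 0 -> (A - s%:M) ^+ p.+1 *m P = 0 ->
  DEspace A s = range (fun y : 'cV[R]_m => (A - s%:M) ^+ p *m P *m y).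
Proof.
set B := A - s%:M => PG D0 BP0.
have GP y : GEspace A s (P *m y).
  by exists p.+1 => //; rewrite -/B mulmxA BP0 mul0mx.
have cordp : is_cord A s p.+1.
  split.
    (* A nonzero column of (A - s)^p P yields a vector of order exactly p + 1. *)
    have [j Dj] : exists j, B ^+ p *m (P *m delta_mx j 0) != 0 :> 'cV_m.
      apply: contrapT => /forallNP DN; case/eqP: D0; apply/matrixP => i j.
      have /negP/negbNE/eqP/matrixP/(_ i 0) := DN j.
      by rewrite mulmxA -colE !mxE.
    exists (P *m delta_mx j 0); split => //.
      by move=> P0; case/eqP: Dj; rewrite P0 mulmx0.
    split => // [|k _ Bk]; first by rewrite -/B mulmxA BP0 mul0mx.
    rewrite ltnNge; apply: contraNN Dj => kp; apply/eqP.
    by rewrite -(subnK kp) exprD -[_ * _]/(_ *m _) -mulmxA -/B Bk mulmx0.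
  move=> xi k xi0 xiG [_ _ kmin]; apply: kmin => //.
  by rewrite -(PG _ xiG) -/B mulmxA BP0 mul0mx.
apply/seteqP; split=> [x|x [y _ <-]].
  move=> [n [c [u [uD ->]]]].
  elim/big_ind: _ => [|_ _ [a _ <-] [b _ <-]|j _].
  - by exists 0 => //; rewrite mulmx0.
  - by exists (a + b) => //; rewrite mulmxDr.
  - have [nu [nucord [_ _ [xi xiG ->]]]] := uD j.
    rewrite (is_cord_unique _ _ _ _ nucord cordp) /=.
    by exists (c j *: xi) => //; rewrite -mulmxA -!scalemxAr PG.
(* Zero is not an eigenvector; it is reached as the empty combination. *)
have [->|x0] := eqVneq (B ^+ p *m P *m y) 0.
  exists 0, (fun _ => 0), (fun _ => 0); split; first by case.
  by rewrite big_ord0.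
exists 1, (fun _ => 1), (fun _ => B ^+ p *m P *m y); split; last first.
  by rewrite big_ord1 scale1r.
move=> _; exists p.+1; split => //; split.
- exact/eqP.
- by rewrite /Espace /= -/B 2!mulmxA -[B *m _]exprS BP0 mul0mx.
- by exists (P *m y) => //; rewrite mulmxA.
Qed.

Lemma dominant_asymptotics {R : realType} {m : nat} (A : 'M[R]_m.+1)
    (s delta : R) :
  spectrum A s%:C -> 0 < delta ->
  (forall mu, spectrum A mu -> mu <> s%:C -> complex.Re mu < s - delta) ->
  exists (p : nat) (D : 'M[R]_m.+1) (C : R),
    [/\ D != 0, (A - s%:M) *m D = 0,
      DEspace A s = range (fun y : 'cV[R]_m.+1 => D *m y), 0 <= C &
      forall t, 1 <= t ->
        fro ((p`!%:R / t ^+ p * expR (- s * t)) *: expmx (t *: A) - D)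
          <= C * t^-1].
Proof.
move=> s_spec delta0 gap; set B := A - s%:M.
have [P [[K BKP] PG [C C0 decay]]] := spectral_projection A s (s - delta) gap.
have exN : exists k, B ^+ k *m P == 0 by exists K; apply/eqP.
(* The least exponent killing P is written p + 1: it is not 0, since P fixes a nonzero
   eigenvector. *)
case: (ex_minnP exN) => -[|p] /eqP Bp pmin.
  have [w w0 Bw] := Espace_neq0 A s s_spec.
  have /PG Pw : GEspace A s w by exists 1 => //; rewrite expr1.
  by case/eqP: w0; rewrite -Pw -[P]mul1mx -[1%:M](expr0 B) Bp mul0mx.
have D0 : B ^+ p *m P != 0.
  by apply/negP => /pmin; rewrite ltnn.
pose M := \sum_(k < p) fro ((p`!%:R / k`!%:R) *: (B ^+ k *m P)).
exists p, (B ^+ p *m P), (M + p`!%:R * C / delta); split => //.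
- by rewrite mulmxA -[B *m _]exprS.
- exact: DEspace_projection.
- rewrite addr_ge0//; last by rewrite divr_ge0 ?mulr_ge0 ?(ltW delta0).
  by apply: sumr_ge0 => k _; exact: fro_ge0.
move=> t t1; have t0 : 0 < t by rewrite (lt_le_trans _ t1).
set E := expmx (t *: A); set c := p`!%:R / t ^+ p.
have c0 : 0 <= c by rewrite divr_ge0// exprn_ge0// ltW.
have cle : c <= p`!%:R by rewrite ler_pdivrMr ?exprn_gt0// ler_peMr// exprn_ege1.
(* The scaled k = p term is exactly D; the others carry t^{k-p} <= 1/t, as t >= 1. *)
have main : c *: (expR (- s * t) *: (E *m P)) - B ^+ p *m P =
    \sum_(k < p) (t ^+ k / t ^+ p) *: ((p`!%:R / k`!%:R) *: (B ^+ k *m P)).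
  rewrite (@expmx_nilpotent _ _ _ A s p.+1)// big_ord_recr /= scalerDr -/B -addrA.
  rewrite [X in _ + X](_ : _ = 0) ?addr0; last first.
    rewrite scalerA (_ : c * _ = 1) ?scale1r ?subrr// /c.
    have : p`!%:R != 0 :> R by rewrite pnatr_eq0 -lt0n fact_gt0.
    have : t ^+ p != 0 by rewrite expf_neq0// gt_eqF.
    by move: (t ^+ p) p`!%:R => a b a0 b0; field; rewrite a0 b0.
  rewrite scaler_sumr; apply: eq_bigr => k _.
  by rewrite !scalerA /c; congr (_ *: _); ring.
have -> : (c * expR (- s * t)) *: E - B ^+ p *m P =
    (c *: (expR (- s * t) *: (E *m P)) - B ^+ p *m P)
    + (c * expR (- s * t)) *: (E *m (1 - P)).
  rewrite mulmxBr mulmx1 scalerBr scalerA; set X := _ *: (E *m P).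
  by apply/matrixP => i j; rewrite !mxE; ring.
apply: le_trans (fro_triangle _ _) _; rewrite mulrDl lerD//.
  rewrite main mulr_suml; apply: le_trans (fro_sum _ _ _) _.
  apply: ler_sum => k _; rewrite froZ mulrC ler_wpM2l ?fro_ge0//.
  rewrite ger0_norm ?divr_ge0 ?exprn_ge0 ?(ltW t0)//.
  rewrite ler_pdivrMr ?exprn_gt0// -(ler_pM2l t0) mulrA mulfV ?gt_eqF// mul1r.
  by rewrite -exprS ler_weXn2l.
rewrite froZ (ger0_norm (mulr_ge0 c0 (expR_ge0 _))).
apply: (@le_trans _ _ (p`!%:R * expR (- s * t) * (C * expR ((s - delta) * t)))).
  apply: ler_pM; rewrite ?fro_ge0 ?(mulr_ge0 c0 (expR_ge0 _))//.
    by rewrite ler_wpM2r ?expR_ge0.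
  by apply: decay; exact: ltW.
have -> : p`!%:R * expR (- s * t) * (C * expR ((s - delta) * t)) =
    p`!%:R * C * expR (- (delta * t)).
  have -> : - (delta * t) = - s * t + (s - delta) * t by ring.
  by rewrite expRD; ring.
(* The bound e^{delta t} >= 1 + delta t >= delta t turns exponential decay into 1/t. *)
rewrite -!mulrA !ler_wpM2l// -invfM expRN lef_pV2 ?posrE ?expR_gt0 ?mulr_gt0//.
by rewrite (le_trans _ (expR_ge1Dx _))// lerDr.
Qed.

(** * Normalized solutions *)

(** The basis hypothesis enters as surjectivity of V, which keeps D V nonzero and gives it the range
    of D. *)
Lemma basis_full_mulmx {R : realType} {m : nat} (v : 'I_m -> 'cV[R]_m) :
  basis_of fullv [seq v i | i <- enum 'I_m] ->
  forall y : 'cV[R]_m, exists c : 'cV[R]_m, y = mx_of_cols v *m c.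
Proof.
move=> /andP[/eqP spanE _] y.
have : y \in <<in_tuple [seq v i | i <- enum 'I_m]>>%VS by rewrite /= spanE memvf.
move=> /coord_span ->; elim/big_ind: _ => [|_ _ [a ->] [b ->]|j _].
- by exists 0; rewrite mulmx0.
- by exists (a + b); rewrite mulmxDr.
- set k := coord _ j _; have /mapP[i _ ->] : (in_tuple [seq v i | i <- enum 'I_m])`_j
      \in [seq v i | i <- enum 'I_m] by rewrite mem_nth.
  exists (k *: delta_mx i 0); rewrite -scalemxAr -colE; congr (_ *: _).
  by apply/matrixP => a b; rewrite !mxE ord1.
Qed.

Lemma linspan_cols {R : realType} {m : nat} (X : 'M[R]_m) :
  linspan (range (fun i => col i X)) = range (fun c : 'cV[R]_m => X *m c).
Proof.
apply/seteqP; split=> [x [n [c [u [uX ->]]]]|x [c _ <-]].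
  elim/big_ind: _ => [|_ _ [a _ <-] [b _ <-]|j _].
  - by exists 0 => //; rewrite mulmx0.
  - by exists (a + b) => //; rewrite mulmxDr.
  - have [i _ <-] := uX j.
    by exists (c j *: delta_mx i 0) => //; rewrite -scalemxAr -colE.
exists m, (fun i => c i 0), (fun i => col i X); split; first by move=> j; exists j.
apply/matrixP => i j; rewrite ord1 !mxE summxE.
by apply: eq_bigr => k _; rewrite !mxE mulrC.
Qed.

Lemma col_mulmx {R : realType} {m n p : nat} (X : 'M[R]_(m, n))
    (Y : 'M[R]_(n, p)) (i : 'I_p) : col i (X *m Y) = X *m col i Y.
Proof. by rewrite !colE mulmxA. Qed.

(** Puts the numerator of the Rayleigh quotient in a form to which Cauchy-Schwarz for matrices
    applies. *)
Lemma sum_dotcv_cols {R : realType} {m : nat} (A X : 'M[R]_m) :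
  \sum_(i < m) dotcv (A *m col i X) (col i X) = mxdot (A *m X) X.
Proof.
rewrite /mxdot exchange_big; apply: eq_bigr => i _.
by apply: eq_bigr => j _; rewrite -col_mulmx !mxE.
Qed.

Theorem theorem3p3 (R : realType) (m : nat) (A : 'M[R]_m)
    (hA : perron_like A) (delta : R) (hdelta : 0 < delta)
    (hgap : forall mu : R[i], spectrum A mu -> mu <> (spectral_bound A)%:C ->
      complex.Re mu <= spectral_bound A - 2 * delta)
    (v : 'I_m -> 'cV[R]_m)
    (hv : basis_of fullv [seq v i | i <- enum 'I_m]) :
  let s := spectral_bound A in
  let x := fun (i : 'I_m) (t : R) => expmx (t *: A) *m v i in
  let X := fun t : R => mx_of_cols (fun i : 'I_m => x i t) in
  exists (B1 B2 : R) (xi : 'I_m -> 'cV[R]_m),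
    0 < B1 /\ 0 < B2 /\
    (forall i : 'I_m, Espace A s (xi i)) /\
    \sum_(i < m) norm2 (xi i) ^+ 2 = 1 /\
    DEspace A s = linspan (range xi) /\
    exists C1 C2 : R, 0 < C1 /\ 0 < C2 /\
      (forall (i : 'I_m) (t : R), 1 <= t ->
        norm2 ((mxnorm2 (X t))^-1 *: x i t - xi i)
          <= C1 * t^-1 + B1 * expR (- delta * t)) /\
      (forall t : R, 1 <= t ->
        `|(mxnorm2 (X t) ^+ 2)^-1 * (\sum_(i < m) dotcv (A *m x i t) (x i t)) - s|
          <= C2 * t^-1 + B2 * expR (- delta * t)).
Proof.
case: m A hA hgap v hv => [|m] A [s_spec _] hgap v hv s x X.
  (* For m = 0 the characteristic polynomial is 1 and has no root s. *)
  by move/spectrum_root: s_spec; rewrite /char_poly det_mx00 rmorph1 (negPf (root1 _)).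
(* Giving up half of the gap 2 delta makes the inequality strict. *)
have gap mu : spectrum A mu -> mu <> s%:C -> complex.Re mu < s - delta.
  by move=> h1 h2; apply: le_lt_trans (hgap mu h1 h2) _; rewrite -/s; lra.
have [p [D [C [D0 AD DE C0 HC]]]] := dominant_asymptotics A s delta s_spec hdelta gap.
have vspan := basis_full_mulmx v hv.
set V := mx_of_cols v in vspan.
have DV0 : D *m V != 0.
  apply: contraNneq D0 => DV0; apply/eqP/matrixP => i j.
  have [c Ec] := vspan (delta_mx j 0).
  have : D *m (V *m c) = 0 by rewrite mulmxA DV0 mul0mx.
  by rewrite -Ec -colE => /matrixP/(_ i 0); rewrite !mxE.
have f0 : 0 < fro (D *m V) by rewrite lt_def fro_eq0 DV0 fro_ge0.
pose Xi := (fro (D *m V))^-1 *: (D *m V).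
have colX t i : col i (X t) = x i t.
  by apply/matrixP => a b; rewrite !mxE ord1.
have XE t : X t = expmx (t *: A) *m V.
  apply/matrixP => a b; rewrite !mxE.
  by apply: eq_bigr => k _; rewrite mxE.
have froXi : fro Xi = 1.
  by rewrite froZ ger0_norm ?invr_ge0 ?fro_ge0// mulVf ?gt_eqF.
have AXi : (A - s%:M) *m Xi = 0.
  by rewrite -scalemxAr mulmxA AD mul0mx scaler0.
pose Z t := (fro (X t))^-1 *: X t.
pose K := 2 * (fro (D *m V))^-1 * (C * fro V).
have K0 : 0 <= K by rewrite !mulr_ge0 ?invr_ge0 ?fro_ge0.
have ZXi t : 1 <= t -> fro (Z t - Xi) <= K * t^-1.
  move=> t1; have t0 : 0 < t by rewrite (lt_le_trans _ t1).
  set c := p`!%:R / t ^+ p * expR (- s * t).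
  have c0 : 0 < c.
    by rewrite mulr_gt0 ?expR_gt0 ?divr_gt0 ?exprn_gt0// ltr0n fact_gt0.
  (* Normalization ignores the positive factor c, so the asymptotics of c X can be used. *)
  have -> : Z t = (fro (c *: X t))^-1 *: (c *: X t).
    by rewrite froZ gtr0_norm// scalerA invfM mulrAC mulVf ?mul1r ?gt_eqF.
  apply: le_trans (normalize_dist (c *: X t) (D *m V) DV0) _.
  rewrite /K -[leRHS]mulrA ler_wpM2l ?mulr_ge0 ?invr_ge0 ?fro_ge0//.
  rewrite XE scalemxAl -mulmxBl; apply: le_trans (fro_mulmx _ _) _.
  by rewrite mulrAC ler_wpM2r ?fro_ge0 ?HC.
(* The first summand serves the Rayleigh identity; |s| covers the case [X t = 0], where the
   convention 0^-1 = 0 makes the quotient 0. *)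
pose L := (fro (A - s%:M) + `|s|) * K.
have L0 : 0 <= L by rewrite mulr_ge0// addr_ge0 ?fro_ge0.
(* The errors are already O(1/t), so the exponential terms are mere slack and any positive
   coefficients do. *)
exists 1, 1, (fun i => col i Xi); do 2 (split; first by []).
split.
  move=> i; rewrite /Espace /= -col_mulmx AXi.
  by apply/matrixP => a b; rewrite !mxE.
split.
  rewrite -[RHS](expr1n _ 2) -froXi -mxnorm2E sqr_sqrtr//.
  by rewrite sumr_ge0// => i _; exact: sqr_ge0.
split.
  rewrite DE linspan_cols; apply/seteqP; split => _ [y _ <-].
    have [c ->] := vspan y; exists (fro (D *m V) *: c) => //.
    by rewrite -scalemxAr -scalemxAl scalerA mulfV ?gt_eqF// scale1r mulmxA.
  exists ((fro (D *m V))^-1 *: (V *m y)) => //.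
  by rewrite -scalemxAr -scalemxAl mulmxA.
exists (K + 1), (L + 1); do 2 (split; first by rewrite ltr_wpDl).
have bnd M e t : 1 <= t -> e <= M * t^-1 ->
    e <= (M + 1) * t^-1 + 1 * expR (- delta * t).
  move=> t1 le; have : 0 <= t^-1 by rewrite invr_ge0 (le_trans _ t1).
  have := expR_ge0 (- delta * t); lra.
split=> [i t t1|t t1]; apply: (bnd _ _ _ t1).
  rewrite mxnorm2E -colX (_ : _ - _ = col i (Z t - Xi)).
    by apply: le_trans (norm2_col_le _ _) _; exact: ZXi.
  by apply/matrixP => a b; rewrite !mxE.
have ZXit := ZXi t t1.
have -> : \sum_(i < m.+1) dotcv (A *m x i t) (x i t) = mxdot (A *m X t) (X t).
  by rewrite -sum_dotcv_cols; apply: eq_bigr => i _; rewrite colX.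
rewrite mxnorm2E.
have [X0|X0] := eqVneq (X t) 0.
  (* X t never vanishes, but if it did, Xi would be within K / t of 0. *)
  rewrite X0 mulmx0 fro0 expr0n invr0 mul0r sub0r normrN.
  move: ZXit; rewrite /Z X0 scaler0 sub0r froN froXi => le1.
  rewrite /L -mulrA; apply: (@le_trans _ _ (`|s| * (K * t^-1))).
    by rewrite ler_peMr.
  by rewrite ler_wpM2r ?(le_trans _ le1)// lerDr fro_ge0.
have fX0 : fro (X t) != 0 by rewrite fro_eq0.
have froZ1 : fro (Z t) = 1.
  by rewrite froZ ger0_norm ?invr_ge0 ?fro_ge0// mulVf.
have -> : (fro (X t) ^+ 2)^-1 * mxdot (A *m X t) (X t) - s =
    mxdot ((A - s%:M) *m (Z t - Xi)) (Z t).
  rewrite mulmxBr AXi subr0 mulmxBl mxdotDl mxdotNl mul_scalar_mx mxdotZl.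
  rewrite -sqr_fro froZ1 expr1n mulr1; congr (_ - _).
  by rewrite -scalemxAr mxdotZl mxdotZr mulrA -invfM expr2.
apply: le_trans (abs_mxdot_le _ _) _; rewrite froZ1 mulr1.
apply: le_trans (fro_mulmx _ _) _; rewrite /L -mulrA.
apply: ler_pM; rewrite ?fro_ge0// lerDl//.
Qed.
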